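(* Let $h\ge 0$ be real and, for $n\ge2$, let $\Lambda_n^h$ denote the largest eigenvalue of the real symmetric matrix $\hat B_n^h$. Then $\Lambda_n^h$ is strictly increasing in $n$, i.e. $\Lambda_{n}^h<\Lambda_{n+1}^h$ for all $n\ge2$, and $\Lambda_n^h<h+\epsilon$ for all $n\ge 2$, where $\epsilon\approx 2.04998$ is the largest real root of $x^3-x^2-\frac{13}{4}x+\frac94$.
   Context: For $n\ge2$ and real $h$, $B_n^h$ is the $n\times n$ matrix with all diagonal entries $h$, $(i,i+1)$ and $(i+1,i)$ entries equal to $-1$ for $1\le i\le n-1$ except that the $(n-1,n)$ entry is $-2$, and all other entries $0$ (the Cartan matrix of type $B_n$ with diagonal $2$'s replaced by $h$). For a square real matrix $H$ with transpose $H'$, $\hat H=\frac{H+H'}2$; thus $\hat B_n^h$ is symmetric tridiagonal with diagonal $h$, off-diagonal entries $-1$, except that the entries in positions $(n-1,n)$ and $(n,n-1)$ are $-\frac32$. *)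

(* Defs.v *)
From mathcomp Require Import all_boot all_order all_algebra.
From mathcomp Require Import reals.
Set Implicit Arguments.
Unset Strict Implicit.
Unset Printing Implicit Defensive.
Import Order.TTheory GRing.Theory Num.Theory.
Local Open Scope ring_scope.

(* Indices are 0-based: the exceptional entry -2 sits at (n - 2, n - 1).
   Only n >= 2 is meaningful. *)
Definition cartanB (R : realType) (h : R) (n : nat) : 'M[R]_n :=
  \matrix_(i < n, j < n)
    if i == j then h
    else if (j == i.+1 :> nat) then (if j.+1 == n then - 2 else - 1)
    else if (i == j.+1 :> nat) then - 1
    else 0.

Definition sym_part (R : realType) (n : nat) (H : 'M[R]_n) : 'M[R]_n :=
  2^-1 *: (H + H^T).

Definition largest_eigenvalue (R : realType) (n : nat) (A : 'M[R]_n) (l : R)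
    : Prop :=
  eigenvalue A l /\ (forall a : R, eigenvalue A a -> a <= l).

Definition largest_root (R : realType) (p : {poly R}) (x : R) : Prop :=
  root p x /\ (forall y : R, root p y -> y <= x).

Definition epsilon_poly (R : realType) : {poly R} :=
  'X^3 - 'X^2 - (13 / 4) *: 'X + (9 / 4)%:P.

(* Main.v *)
Require Import Defs.
From mathcomp Require Import all_boot all_order all_algebra.
From mathcomp Require Import reals.
From mathcomp Require Import boolp ring lra.
Import Order.TTheory GRing.Theory Num.Theory.
Local Open Scope ring_scope.

(** Up to the shift by [h] and the signs (-1)^i on the basis, the matrix is a
   path Jacobi matrix with last coupling 3/2.  Solving its eigenvector equation
   from the first coordinate on shows that [h + a] is an eigenvalue iff [a] is a
   root of f_n = X U_(n-1) - 9/4 U_(n-2), where U_k are the Chebyshev polynomials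
   U_(k+2) = X U_(k+1) - U_k.  These also satisfy f_(n+2) = X f_(n+1) - f_n, so at the
   largest root m of f_(n+1), which by induction exceeds that of f_n, one has
   f_(n+2)(m) = - f_n(m) < 0 and f_(n+2) has a root beyond m.  Finally, for
   x >= 9/8 + 8/9 = 145/72 (which is less than eps) the recurrence preserves
   U_(k+1)(x) >= 9/8 U_k(x) > 0, and this makes f_n(x) positive. *)

(** Induction on the degree: after dividing out ['X - x%:P], the larger of [x] and the largest root
    of the quotient works, or [x] itself if the quotient has no root. *)
Lemma ex_largest_root (R : realType) (p : {poly R}) (x : R) :
  p != 0 -> root p x -> exists y, largest_root p y.
Proof.
have [n] := ubnP (size p); elim: n p x => // n IHn p x; rewrite ltnS => sz_p p0.
move=> /factor_theorem [q def_p].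
have q0 : q != 0 by apply: contraNneq p0 => q0; rewrite def_p q0 mul0r.
have sz_q : (size q < n)%N.
  by move: sz_p; rewrite def_p size_Mmonic ?monicXsubC// size_XsubC addn2.
have rootE z : root p z = root q z || (z == x).
  by rewrite def_p rootM root_XsubC.
have [[z qz]|noroot] := pselect (exists z, root q z).
  have [y [qy ymax]] := IHn q z sz_q q0 qz.
  exists (Num.max x y); split=> [|t].
    by rewrite rootE; case: (leP x y) => _; rewrite ?qy ?eqxx ?orbT.
  rewrite rootE le_max => /orP[/ymax ->|/eqP ->]; by rewrite ?orbT ?lexx.
exists x; split=> [|t]; first by rewrite rootE eqxx orbT.
by rewrite rootE => /orP[qt|/eqP -> //]; case: noroot; exists t.
Qed.

Lemma ex_largest_root_gt (R : realType) (p : {poly R}) (x b : R) :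
  (forall y, b <= y -> 0 < p.[y]) -> p.[x] < 0 ->
  exists2 y, largest_root p y & x < y.
Proof.
move=> p_gt0 px.
have p0 : p != 0 by apply: contraTneq (p_gt0 b (lexx b)) => ->; rewrite horner0 ltxx.
have xb : x <= b by rewrite leNgt; apply/negP => /ltW /p_gt0; rewrite ltNge (ltW px).
have [|z /andP[xz zb] pz] := @poly_ivt R p x b xb.
  by rewrite (ltW px) (ltW (p_gt0 b _)).
have [y ly] := ex_largest_root _ _ _ p0 pz; exists y => //.
apply: lt_le_trans (ly.2 _ pz).
rewrite lt_neqAle xz andbT; apply: contraTneq px => ->.
by rewrite (rootP pz) ltxx.
Qed.

(** A nonpositive value at [y] would produce a root in [y, max(y, b)], hence beyond [m]. *)
Lemma gt0_above_largest_root {R : realType} {p : {poly R}} {m b : R} :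
  (forall y, b <= y -> 0 < p.[y]) -> largest_root p m ->
  forall y, m < y -> 0 < p.[y].
Proof.
move=> p_gt0 [_ mmax] y my; rewrite ltNge; apply/negP => py.
have [||z /andP[yz _] pz] := @poly_ivt R p y (Num.max y b).
- by rewrite le_max lexx.
- by rewrite py (ltW (p_gt0 _ _))// le_max lexx orbT.
- by have := lt_le_trans my yz; rewrite ltNge mmax.
Qed.

(** Second kind, rescaled: U_n(2 cos t) = sin((n+1)t) / sin t. *)
Fixpoint chebU (R : realType) (n : nat) : {poly R} :=
  if n is m.+1 then if m is k.+1 then 'X * chebU R m - chebU R k else 'X else 1.

(* The characteristic polynomial of the symmetrized matrix of size [n.+1]
   at [h = 0]. *)
Definition secB (R : realType) (n : nat) : {poly R} :=
  if n is m.+1 then 'X * chebU R m.+1 - (9 / 4) *: chebU R m else 'X.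

Lemma chebUSS (R : realType) n :
  chebU R n.+2 = 'X * chebU R n.+1 - chebU R n.
Proof. by []. Qed.

(** The recurrence is linear, so it passes from [chebU] to [secB]; the value ['X] at index 0
    corresponds to U_(-1) = 0 and makes it hold from the start. *)
Lemma secBSS (R : realType) n : secB R n.+2 = 'X * secB R n.+1 - secB R n.
Proof.
case: n => [|n]; rewrite /secB !chebUSS -!mul_polyC; last by ring.
by rewrite /chebU; ring.
Qed.

Lemma chebU_growth (R : realType) (x : R) n : 145 / 72 <= x ->
  0 < (chebU R n).[x] /\ 9 / 8 * (chebU R n).[x] <= (chebU R n.+1).[x].
Proof.
move=> hx; elim: n => [|n [p0 p1]]; first by rewrite /= hornerX hornerC; split; lra.
rewrite chebUSS !hornerE.
(* U_(n+2) >= (x - 8/9) U_(n+1) >= 9/8 U_(n+1), since U_n <= 8/9 U_(n+1). *)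
by split; nra.
Qed.

Lemma secB_gt0 (R : realType) n (x : R) : 145 / 72 <= x -> 0 < (secB R n).[x].
Proof.
move=> hx; case: n => [|n]; first by rewrite /= hornerX; lra.
have [p0 p1] := chebU_growth R x n hx; rewrite /secB !hornerE.
(* The growth gives x U_(n+1) >= 145/72 * 9/8 U_n = 145/64 U_n, just above 9/4 U_n = 144/64 U_n. *)
nra.
Qed.

Lemma secB_largest_root_lt (R : realType) n :
  exists2 m : R, largest_root (secB R n) m &
  exists2 m', largest_root (secB R n.+1) m' & m < m'.
Proof.
elim: n => [|n [m lm [m' lm' mm']]].
  exists 0; first by split=> [|y]; rewrite /= rootE hornerX // => /eqP ->.
  apply: ex_largest_root_gt (@secB_gt0 R 1) _.
  by rewrite !hornerE; lra.
exists m' => //; apply: ex_largest_root_gt (@secB_gt0 R n.+2) _.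
have := gt0_above_largest_root (@secB_gt0 R n) lm _ mm'.
by rewrite secBSS hornerD hornerN hornerM hornerX (rootP lm'.1) mulr0 sub0r oppr_lt0.
Qed.

Lemma largest_root_uniq {R : realType} {p : {poly R}} {x y : R} :
  largest_root p x -> largest_root p y -> x = y.
Proof. by move=> [px xm] [py ym]; apply/le_anti; rewrite xm // ym. Qed.

(* [coupB n i] is the coupling, up to sign, between coordinates [i] and [i.+1]. *)
Definition coupB (R : realType) (n i : nat) : R :=
  if i.+2 == n then 3 / 2 else 1.

Lemma sym_cartanBE (R : realType) (h : R) n (i j : 'I_n) :
  sym_part (cartanB h n) i j =
    (if (i == j :> nat) then h else 0)
    - (if (j == i.+1 :> nat) then coupB R n i else 0)
    - (if (i == j.+1 :> nat) then coupB R n j else 0).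
Proof.
rewrite /sym_part /coupB !mxE -!(inj_eq val_inj) /= (eq_sym (j : nat) i).
case: (ltngtP i j) => [ij|ij|->].
- rewrite [_ == j.+1]ltn_eqF ?ltnS 1?ltnW //.
  case: (eqVneq (j : nat) i.+1) => [->|_]; first by case: ifP => _; lra.
  lra.
- rewrite [_ == i.+1]ltn_eqF ?ltnS 1?ltnW //.
  case: (eqVneq (i : nat) j.+1) => [->|_]; first by case: ifP => _; lra.
  lra.
- by rewrite ltn_eqF //; lra.
Qed.

(** Extending row vectors by zero to sequences on [nat] lets the last column obey the same
    three-term formula as the inner ones. *)
Lemma sum_sym_cartanB (R : realType) (h : R) n (w : nat -> R) (j : 'I_n) :
  (forall i, (n <= i)%N -> w i = 0) ->
  \sum_(i < n) w i * sym_part (cartanB h n) i j =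
    h * w j - (if (j : nat) is k.+1 then coupB R n k * w k else 0)
    - coupB R n j * w j.+1.
Proof.
move=> w0; under eq_bigr do rewrite sym_cartanBE !mulrBr.
rewrite !sumrB; congr (_ - _ - _).
- under eq_bigr do rewrite (fun_if ( *%R _)) mulr0.
  by rewrite -big_mkcond (big_ord1_eq _ (fun i => w i * h)) ltn_ord mulrC.
- case: j => [[|k] ltk] /=; first by rewrite big1 // => i _; rewrite mulr0.
  under eq_bigr do rewrite (fun_if ( *%R _)) mulr0 eqSS eq_sym.
  by rewrite -big_mkcond (big_ord1_eq _ (fun i => w i * coupB R n i)) ltnW // mulrC.
- under eq_bigr do rewrite (fun_if ( *%R _)) mulr0.
  rewrite -big_mkcond (big_ord1_eq _ (fun i => w i * coupB R n j)).
  by case: ltnP => [_|/w0 ->]; rewrite ?mulr0 1?mulrC.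
Qed.

(** Twisting by (-1)^i makes the couplings positive, and [h] cancels from both sides of the
    eigenvector equation. *)
Lemma eigenvector_seqP (R : realType) (h a : R) n :
  reflect
    (exists w : nat -> R,
      [/\ forall i, (n <= i)%N -> w i = 0,
          exists i, w i != 0
        & forall j, (j < n)%N ->
            a * w j = (if j is k.+1 then coupB R n k * w k else 0)
                      + coupB R n j * w j.+1])
    (eigenvalue (sym_part (cartanB h n)) (h + a)).
Proof.
apply: (iffP eigenvalueP) => [[v va v0]|[w [w0 [i0 wi0] wa]]].
  pose u i : R := oapp (v 0) 0 (insub i : option 'I_n).
  have uE (i : 'I_n) : u i = v 0 i by rewrite /u valK.
  have u0 i : (n <= i)%N -> u i = 0 by move=> ni; rewrite /u insubF // ltnNge ni.
  exists (fun i => (-1) ^+ i * u i); split.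
  - by move=> i /u0 ->; rewrite mulr0.
  - have /rV0Pn [i vi] := v0; exists i.
    by rewrite mulf_neq0 ?signr_eq0 // uE.
  move=> j jn; have := congr1 (fun M : 'rV_n => M 0 (Ordinal jn)) va.
  rewrite !mxE; under eq_bigr do rewrite -uE.
  rewrite sum_sym_cartanB // -uE /= => E.
  case: j jn E => [|k] _ E; rewrite !exprS ?expr0; first by lra.
  (* After multiplication by the common sign, the goal is linear in the same monomials. *)
  have := congr1 ( *%R ((-1) ^+ k)) E; lra.
exists (\row_(i < n) ((-1) ^+ i * w i)).
  apply/rowP => j; rewrite !mxE; under eq_bigr do rewrite mxE.
  rewrite (sum_sym_cartanB _ _ _ (fun i => (-1) ^+ i * w i)); last first.
    by move=> i /w0 ->; rewrite mulr0.
  have := wa j (ltn_ord j); case: j => [[|k] jn] /=; rewrite ?exprS ?expr0.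
    lra.
  by move=> E; have := congr1 ( *%R ((-1) ^+ k)) E; lra.
have i0n : (i0 < n)%N by rewrite ltnNge; apply: contra wi0 => /w0 ->.
apply/eqP => /rowP /(_ (Ordinal i0n)); rewrite !mxE /= => /eqP.
by rewrite mulf_eq0 signr_eq0 (negPf wi0).
Qed.

Lemma eigenvalue_sym_cartanB (R : realType) (h a : R) n :
  eigenvalue (sym_part (cartanB h n.+2)) (h + a) = root (secB R n.+1) a.
Proof.
have c1 i : (i < n)%N -> coupB R n.+2 i = 1.
  by move=> lt_in; rewrite /coupB !eqSS ltn_eqF.
have cn : coupB R n.+2 n = 3 / 2 by rewrite /coupB eqxx.
(* This default coupling past the last coordinate multiplies [w n.+2], which is 0. *)
have cn1 : coupB R n.+2 n.+1 = 1 by rewrite /coupB gtn_eqF.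
apply/eigenvector_seqP/rootP => [[w [w0 [i0 wi0] wa]]|fa].
  (* The second conjunct keeps the coupling as a factor, so that it also covers k = n, where the
     coupling is 3/2. *)
  have wU k : (k <= n)%N -> w k = (chebU R k).[a] * w 0%N /\
     coupB R n.+2 k * w k.+1 = (chebU R k.+1).[a] * w 0%N.
    elim: k => [_|k IHk lt_kn].
      by have := wa 0%N isT; rewrite /= hornerC hornerX; lra.
    have [wk wk1] := IHk (ltnW lt_kn); rewrite c1 // mul1r in wk1.
    have := wa k.+1 (leqW (lt_kn : (k.+2 <= n.+1)%N)).
    rewrite c1 // chebUSS !hornerE wk1 wk; lra.
  have [wn wn1] := wU n (leqnn n); rewrite cn in wn1.
  have := wa n.+1 (leqnn _); rewrite cn cn1 (w0 n.+2) // => wl.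
  (* All coordinates are multiples of the first, so [w 0] can be cancelled from the last
     equation. *)
  have w00 : w 0%N != 0.
    apply: contraNneq wi0 => w00; case: (leqP i0 n) => [/wU[-> _]|].
      by rewrite w00 mulr0 eqxx.
    rewrite leq_eqVlt => /predU1P[<-|/w0 ->]; last by rewrite eqxx.
    by move: wn1; rewrite w00 => wn1; apply/eqP; lra.
  apply: (mulIf w00); rewrite mul0r /secB !hornerE.
  by rewrite mulrBl -!mulrA -wn1 -wn; lra.
(* The factor 2/3 on the last coordinate compensates the coupling 3/2; the last equation is then 2/3
   of f(a) = 0. *)
pose w k : R := if (k <= n)%N then (chebU R k).[a] else
  if k == n.+1 then 2 / 3 * (chebU R k).[a] else 0.
have wU k : (k <= n)%N -> w k = (chebU R k).[a] by rewrite /w => ->.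
have wn1 : w n.+1 = 2 / 3 * (chebU R n.+1).[a] by rewrite /w ltnn eqxx.
have w0 i : (n.+2 <= i)%N -> w i = 0.
  by move=> ni; rewrite /w leqNgt (ltnW ni) /= gtn_eqF.
have cw k : (k <= n)%N -> coupB R n.+2 k * w k.+1 = (chebU R k.+1).[a].
  rewrite leq_eqVlt => /predU1P[->|kn]; first by rewrite cn wn1; lra.
  by rewrite c1 // mul1r wU.
exists w; split=> //.
  by exists 0%N; rewrite wU // hornerC oner_eq0.
move=> [_|j]; first by rewrite cw // wU // hornerC hornerX; lra.
rewrite ltnS leq_eqVlt => /predU1P[[->]|]; last first.
  rewrite ltnS => jn; rewrite cw // c1 // (wU j.+1) // (wU j) 1?ltnW //.
  by rewrite chebUSS hornerD hornerN hornerM hornerX; lra.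
rewrite (w0 n.+2) // cn wn1 wU //.
by move: fa; rewrite /secB mulr0 hornerD hornerN hornerM hornerX hornerZ; lra.
Qed.

(** Expanded in powers of the distance [y] to the bound, the cubic has only positive
    coefficients. *)
Lemma epsilon_poly_gt0 (R : realType) (x : R) :
  2 + 4998 / 10 ^+ 5 + 5 / 10 ^+ 6 <= x -> 0 < (epsilon_poly R).[x].
Proof.
move=> hx; rewrite /epsilon_poly !hornerE.
have : 0 <= x - (2 + 4998 / 10 ^+ 5 + 5 / 10 ^+ 6) by lra.
set y := x - _ => y0; have -> : x = y + (2 + 4998 / 10 ^+ 5 + 5 / 10 ^+ 6) by rewrite /y; lra.
have := exprn_ge0 2 y0; have := exprn_ge0 3 y0; lra.
Qed.

Theorem mainTheorem2 (R : realType) (h : R) (h_ge0 : 0 <= h) :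
  exists (Lambda : nat -> R) (eps : R),
    [/\ forall n : nat, (2 <= n)%N ->
          largest_eigenvalue (sym_part (cartanB h n)) (Lambda n),
        largest_root (epsilon_poly R) eps,
        `|eps - (2 + 4998 / 10 ^+ 5)| <= 5 / 10 ^+ 6,
        forall n : nat, (2 <= n)%N -> Lambda n < Lambda n.+1
      & forall n : nat, (2 <= n)%N -> Lambda n < h + eps].
Proof.
have ex_m n : exists m : R, largest_root (secB R n) m.
  by have [m lm _] := secB_largest_root_lt R n; exists m.
have [m mP] := choice ex_m.
have [eps leps eps_gt] : exists2 eps : R, largest_root (epsilon_poly R) eps &
    2 + 4998 / 10 ^+ 5 - 5 / 10 ^+ 6 < eps.
  (* The cubic is negative at the lower end of the interval of radius 5/10^6 about 2.04998 and
     positive from the upper end on. *)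
  apply: ex_largest_root_gt (@epsilon_poly_gt0 R) _.
  by rewrite /epsilon_poly !hornerE; lra.
have eps_lt : eps < 2 + 4998 / 10 ^+ 5 + 5 / 10 ^+ 6.
  rewrite ltNge; apply/negP => /epsilon_poly_gt0.
  by rewrite (rootP leps.1) ltxx.
(* [secB R k] belongs to size [k.+1], whence the shifted index. *)
exists (fun n => h + m n.-1), eps; split=> //.
- case=> [|[|n]] // _; have [mn mmax] := mP n.+1; split=> [|a].
    by rewrite eigenvalue_sym_cartanB.
  by rewrite -[a](subrKC h) eigenvalue_sym_cartanB lerD2l; apply: mmax.
- by rewrite ler_norml; apply/andP; split; lra.
- case=> [|n] // _; rewrite ltrD2l /=.
  have [x lx [y ly xy]] := secB_largest_root_lt R n.
  by rewrite (largest_root_uniq (mP n) lx) (largest_root_uniq (mP n.+1) ly).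
- move=> n _; rewrite ltrD2l.
  (* 145/72 = 2.0138... lies below the lower bound 2.049975 for [eps]. *)
  suff : m n.-1 < 145 / 72 by lra.
  rewrite ltNge; apply/negP => /(@secB_gt0 R n.-1).
  by rewrite (rootP (mP n.-1).1) ltxx.
Qed.
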